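(* Let $\gamma(s)=\alpha(s)+\varepsilon\beta(s)$, $s\in I\subset\mathbb{R}$, be a spacelike curve in $\mathbb{D}_1^2$ parametrized by arc-length, with $\alpha''\neq0$ on $I$. The curve $\gamma$ has constant curvature $r_\gamma=r_\alpha+\varepsilon m$, where $r_\alpha,m\in\mathbb{R}$ and $r_\alpha\neq0$, if and only if, up to the isometries of $\mathbb{L}^2$, the real part $\alpha$ is given by $$\alpha(s)=r_\alpha\left(\sinh\frac{s}{r_\alpha},\cosh\frac{s}{r_\alpha}\right),$$ and the dual part satisfies $$\beta(s)=\left(-mr_\alpha^2\sinh\frac{s}{r_\alpha}+(ms+n)r_\alpha\cosh\frac{s}{r_\alpha},\; -mr_\alpha^2\cosh\frac{s}{r_\alpha}+(ms+n)r_\alpha\sinh\frac{s}{r_\alpha}\right)+\beta_0,$$ where $n\in\mathbb{R}$ is a constant and $\beta_0\in\mathbb{L}^2$ is a constant vector.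
   Context: $\mathbb{D}=\{x+\varepsilon y: x,y\in\mathbb{R}\}$, with $\varepsilon^2=0$ and $\varepsilon\neq0$, is the ring of dual numbers. $\mathbb{L}^2$ is the Lorentz-Minkowski plane, that is, $\mathbb{R}^2$ with the metric $\langle u,v\rangle=u_1v_1-u_2v_2$, and $\mathbb{D}_1^2$ is $\mathbb{D}^2$ with the extension of this metric under the rule $\varepsilon^2=0$. Here $I$ is an interval and a smooth curve of a real variable in $\mathbb{D}_1^2$ is written $\gamma=\alpha+\varepsilon\beta$ with $\alpha,\beta:I\to\mathbb{L}^2$ smooth, called its real and dual parts. The curve $\gamma$ is spacelike if its real part is, i.e. $\alpha'(s)$ is a nonzero vector with $\langle\alpha'(s),\alpha'(s)\rangle>0$ for all $s\in I$. A spacelike $\gamma$ is parametrized by arc-length if $\langle\alpha',\alpha'\rangle=1$ and $\langle\alpha',\beta'\rangle=0$ on $I$. When $\alpha''\neq0$ on $I$, the curvature of $\gamma$ is $\kappa_\gamma=|\gamma''|=\sqrt{|\langle\gamma'',\gamma''\rangle|}$, a $\mathbb{D}$-valued function; for dual numbers with $a\neq0$, $|a+\varepsilon b|=\mathrm{sign}(a)(a+\varepsilon b)$, and for $a>0$, $\sqrt{a+\varepsilon b}=\sqrt a+\varepsilon\frac{b}{2\sqrt a}$. An isometry of $\mathbb{L}^2$ is an affine map $p\mapsto Ap+b$ with $b\in\mathbb{L}^2$ and $A$ a real $2\times2$ matrix satisfying $A^\top MA=M$, where $M=\mathrm{diag}(1,-1)$.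
   Formalization: The constant curvature is taken as |1/r_α + εm| (dual absolute value) instead of r_α + εm: the printed curve has curvature 1/|r_α| + ε sign(r_α)m, so the claim as printed fails, e.g. for r_α = 2, m = 0, β = 0. *)

(* Defs.v *)
From HB Require Import structures.
From mathcomp Require Import all_boot all_order all_algebra.
From mathcomp Require Import all_classical all_reals all_analysis.

Set Implicit Arguments.
Unset Strict Implicit.
Unset Printing Implicit Defensive.

Import Order.TTheory GRing.Theory Num.Theory.
Import numFieldNormedType.Exports.

Local Open Scope classical_set_scope.
Local Open Scope ring_scope.

Record dual (R : Type) := Dual { re : R ; du : R }.

Section DualRing.
Variable R : comNzRingType.
Implicit Types x y z : dual R.

Definition dual_pair x : R * R := (re x, du x).
Definition pair_dual (p : R * R) : dual R := Dual p.1 p.2.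

Lemma dual_pairK : cancel dual_pair pair_dual. Proof. by case. Qed.

HB.instance Definition _ := Choice.copy (dual R) (can_type dual_pairK).

Definition dual0 : dual R := Dual 0 0.
Definition dual1 : dual R := Dual 1 0.
Definition dual_opp x : dual R := Dual (- re x) (- du x).
Definition dual_add x y : dual R := Dual (re x + re y) (du x + du y).
Definition dual_mul x y : dual R :=
  Dual (re x * re y) (re x * du y + du x * re y).

Lemma dual_addA : associative dual_add.
Proof. by move=> x y z; rewrite /dual_add /= !addrA. Qed.
Lemma dual_addC : commutative dual_add.
Proof. by move=> x y; rewrite /dual_add addrC (addrC (du x)). Qed.
Lemma dual_add0 : left_id dual0 dual_add.
Proof. by case=> a b; rewrite /dual_add /= !add0r. Qed.
Lemma dual_addN : left_inverse dual0 dual_opp dual_add.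
Proof. by move=> x; rewrite /dual_add /= !addNr. Qed.

HB.instance Definition _ :=
  GRing.isZmodule.Build (dual R) dual_addA dual_addC dual_add0 dual_addN.

Lemma dual_mulA : associative dual_mul.
Proof.
by move=> x y z; rewrite /dual_mul /= mulrDr mulrDl !mulrA addrA.
Qed.
Lemma dual_mulC : commutative dual_mul.
Proof.
move=> x y; rewrite /dual_mul mulrC; congr Dual.
by rewrite addrC (mulrC (du x)) (mulrC (re x)).
Qed.
Lemma dual_mul1 : left_id dual1 dual_mul.
Proof. by case=> a b; rewrite /dual_mul /= !mul1r mul0r addr0. Qed.
Lemma dual_mulD : left_distributive dual_mul +%R.
Proof.
move=> x y z; rewrite /dual_mul /= !mulrDl; congr Dual.
by rewrite addrACA.
Qed.
Lemma dual_oner_neq0 : dual1 != 0.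
Proof. by apply/eqP => -[/eqP]; rewrite oner_eq0. Qed.

HB.instance Definition _ := GRing.Zmodule_isComNzRing.Build (dual R)
  dual_mulA dual_mulC dual_mul1 dual_mulD dual_oner_neq0.

End DualRing.

(* Intended for re x != 0. *)
Definition dabs (R : rcfType) (x : dual R) : dual R :=
  Dual (Num.sg (re x) * re x) (Num.sg (re x) * du x).

(* Intended for 0 < re x. *)
Definition dsqrt (R : rcfType) (x : dual R) : dual R :=
  Dual (Num.sqrt (re x)) (du x / (2 * Num.sqrt (re x))).

Definition vec2 (R : pzRingType) (x y : R) : 'cV[R]_2 :=
  \col_(i < 2) [:: x; y]`_i.

(* Used over R for the plane L^2, and over dual R for D_1^2, where the product
   of dual R implements the rule eps^2 = 0. *)
Definition lorentz (R : pzRingType) (u v : 'cV[R]_2) : R :=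
  u 0 0 * v 0 0 - u 1 0 * v 1 0.

Definition dual_vec (R : Type) (a b : 'cV[R]_2) : 'cV[dual R]_2 :=
  \col_(i < 2) Dual (a i 0) (b i 0).

Definition dnorm (R : rcfType) (u : 'cV[dual R]_2) : dual R :=
  dsqrt (dabs (lorentz u u)).

Definition lorentz_mx (R : pzRingType) : 'M[R]_2 :=
  diag_mx (\row_(i < 2) [:: 1; -1]`_i).

Definition lorentz_orthogonal (R : pzRingType) (A : 'M[R]_2) : Prop :=
  A^T *m lorentz_mx R *m A = lorentz_mx R.

Definition sinh (R : realType) (x : R) : R := (expR x - expR (- x)) / 2.
Definition cosh (R : realType) (x : R) : R := (expR x + expR (- x)) / 2.

Section Curves.
Variable R : realType.
Implicit Types (I : set R) (f alpha beta : R -> 'cV[R]_2).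

(* A curve on I is a total function of which only the germ along I matters:
   smoothness on I (which may contain its endpoints) means that f is
   infinitely differentiable on an open set containing I. *)
Definition smooth_on I f : Prop :=
  exists U : set R, [/\ open U, I `<=` U &
    forall (n : nat) (s : R), U s -> derivable (derive1n n f) s 1].

Definition spacelike_on I alpha : Prop :=
  forall s, I s -> derive1 alpha s != 0 /\
                   0 < lorentz (derive1 alpha s) (derive1 alpha s).

Definition arclength_on I alpha beta : Prop :=
  forall s, I s -> lorentz (derive1 alpha s) (derive1 alpha s) = 1 /\
                   lorentz (derive1 alpha s) (derive1 beta s) = 0.

Definition curvature alpha beta (s : R) : dual R :=
  dnorm (dual_vec (derive1n 2 alpha s) (derive1n 2 beta s)).

End Curves.

(* Main.v *)
Require Import Defs.
From mathcomp Require Import all_boot all_order all_algebra.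
From mathcomp Require Import all_classical all_reals all_analysis.
From mathcomp Require Import ring lra.
Import Order.TTheory GRing.Theory Num.Theory.
Import numFieldNormedType.Exports.
Local Open Scope classical_set_scope.
Local Open Scope ring_scope.

(** The real part is a classical plane-curve problem and the dual part a linear
    problem on top of it; both are settled by showing that some scalar function
    has zero derivative.

    Write T = alpha' for the unit spacelike tangent. Differentiating
    <T, T> = 1 shows that alpha'' is orthogonal to T, hence timelike, so the
    absolute value inside the dual square root always takes the same branch and
    kappa = |1/r + eps m| splits into two real equations
    ([curvature_eqP]): <alpha'', alpha''> = - 1/r^2 and
    <alpha'', beta''> = - m/r.

    The first equation says that T = (x, y) runs on the hyperbola
    x^2 - y^2 = 1 with x' = w y, y' = w x and w^2 = 1/r^2. The function
    w = x y' - y x' is differentiable and has constant nonzero square, so it is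
    a constant 1/r or - 1/r ([unit_hyperbola_constant_speed]). In the light-cone
    coordinates x + y and x - y the system decouples into two exponentials, and
    rescaling these coordinates by inverse factors, which is a boost, brings T
    to (cosh ws, sinh ws); a reflection of the second axis absorbs the sign of w
    ([unit_tangent_normal_form]). Integrating T gives alpha up to translation.

    After that isometry, <T, beta'> = 0 forces
    beta' = f (sinh (s/r), cosh (s/r)), and the second equation reads f' = m, so
    f = m s + n ([dual_tangent_normal_form]); integrating once more gives beta.
    The converse is the same computation read backwards, after differentiating
    the given identities twice.

    The interval may contain its endpoints, where an equality that holds on I
    does not hold in a neighbourhood. All the arguments above use only
    identities on I and two-sided derivatives at the points of I, and
    [derive_eq_on_interval] is what lets such identities be differentiated
    at endpoints too. *)

(** * Functions on an interval and their derivatives *)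

Set Implicit Arguments.
Unset Strict Implicit.

Section IntervalCalculus.
Context {R : realType}.
Implicit Types (I : set R) (f g : R -> R).

(** The usual rules are about sums and products in the ring of functions; these
    pointwise forms match concrete lambda terms. *)
Lemma is_deriveD_pt f g (s df dg : R) : is_derive s 1 f df ->
  is_derive s 1 g dg -> is_derive s 1 (fun t => f t + g t) (df + dg).
Proof. exact: is_deriveD. Qed.

Lemma is_deriveB_pt f g (s df dg : R) : is_derive s 1 f df ->
  is_derive s 1 g dg -> is_derive s 1 (fun t => f t - g t) (df - dg).
Proof. exact: is_deriveB. Qed.

Lemma is_deriveM_pt f g (s df dg : R) : is_derive s 1 f df ->
  is_derive s 1 g dg ->
  is_derive s 1 (fun t => f t * g t) (df * g s + f s * dg).
Proof.
move=> Hf Hg; have /is_derive_eq := is_deriveM Hf Hg; apply.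
by rewrite addrC [in RHS]mulrC.
Qed.

Lemma nondegenerate_other_point I s : I° !=set0 -> exists2 t, I t & t != s.
Proof.
move=> [c /nbhs_ballP[/= e e0 eI]]; case: (eqVneq c s) => [cs|]; last first.
  by exists c => //; apply: eI; exact: ballxx.
exists (c + e / 2); last by rewrite -cs addrC -subr_eq0 addrK gt_eqF// divr_gt0.
apply: eI; rewrite /ball /= opprD addNKr normrN gtr0_norm ?divr_gt0//.
by rewrite ltr_pdivrMr// ltr_pMr// ltr1n.
Qed.

(** Only the points of I near s are used: they approach s from at least one side
    because I is a nondegenerate interval, and the two-sided limit defining the
    derivative of [f - g] can be computed along them. *)
Lemma derive_eq_on_interval I f g (s df dg : R) :
  is_interval I -> I° !=set0 -> (forall t, I t -> f t = g t) -> I s ->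
  is_derive s 1 f df -> is_derive s 1 g dg -> df = dg.
Proof.
move=> itvI I0 fg Is Hf Hg; have [dF valF] := is_deriveB_pt Hf Hg.
apply/eqP; rewrite -subr_eq0 -valF; apply/negPn/negP => d0.
have [t It ts] := nondegenerate_other_point s I0.
have [/= e e0 nz] := cvgr_neq0 _ dF d0.
(* If (f - g)'(s) <> 0, small enough increments h have a nonzero difference
   quotient; but s + h is in I for some arbitrarily small h = c (t - s). *)
have ts0 : 0 < `|t - s| by rewrite normr_gt0 subr_eq0.
pose c := Num.min 1 (e / 2 / `|t - s|).
have c0 : 0 < c by rewrite lt_min ltr01 !divr_gt0.
have c1 : c <= 1 by rewrite ge_min lexx.
have ce : c * `|t - s| < e.
  rewrite (@le_lt_trans _ _ (e / 2))//; last by lra.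
  by rewrite -ler_pdivlMr// ge_min lexx orbT.
have /nz : ball_ Num.norm 0 e (c * (t - s)).
  by rewrite /= sub0r normrN normrM gtr0_norm.
have h0 : c * (t - s) != 0 by rewrite mulf_eq0 gt_eqF//= subr_eq0.
have hI : I ((c * (t - s)) *: 1 + s).
  rewrite [X in X + s]mulr1; case: (ltP s t) => st.
    by apply: (itvI s t) => //; nra.
  by apply: (itvI t s) => //; nra.
by move=> /(_ h0); rewrite /= !fg// !subrr scaler0 eqxx.
Qed.

Lemma cst_on_interval I f : is_interval I ->
  (forall s, I s -> is_derive s 1 f 0) ->
  exists c, forall s, I s -> f s = c.
Proof.
move=> itvI df0; case: (pselect (I !=set0)) => [[s0 Is0]|I0]; last first.
  by exists 0 => s Is; case: I0; exists s.
have fxy x y : I x -> I y -> x <= y -> f x = f y.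
  move=> Ix Iy xy.
  have sub z : z \in `[x, y] -> I z.
    by rewrite in_itv /= => xzy; exact: itvI Ix Iy _ xzy.
  have dz z : z \in `]x, y[ -> is_derive z 1 f 0.
    by move=> zxy; apply/df0/sub; apply: subset_itv_oo_cc.
  have [|_ _] := @MVT_segment _ f (fun=> 0) _ _ xy dz.
    by apply: derivable_within_continuous => z /sub /df0 [].
  by rewrite mul0r => /subr0_eq.
exists (f s0) => s Is; case: (leP s s0) => [|/ltW] ?; first exact: fxy.
by rewrite (fxy s0 s).
Qed.

Lemma is_derive_expR_scale (k s : R) :
  is_derive s 1 (fun t => expR (k * t)) (k * expR (k * s)).
Proof.
have H : is_derive s 1 (fun t : R => k * t) k.
  have /is_derive_eq := is_deriveM_pt (is_derive_cst k s 1) (is_derive_id s 1).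
  by apply; rewrite mul0r add0r mulr1.
have /is_derive_eq := is_derive1_comp (is_derive_expR (k * s)) H.
by apply; rewrite mulrC.
Qed.

Lemma is_derive_sinh_div (r s : R) :
  is_derive s 1 (fun t => sinh (t / r)) (r^-1 * cosh (s / r)).
Proof.
have -> : (fun t => sinh (t / r)) =
    (fun t => (expR (r^-1 * t) - expR (- r^-1 * t)) * 2^-1).
  by apply/funext => t; rewrite /sinh mulNr (mulrC r^-1).
have /is_derive_eq := is_deriveM_pt (is_deriveB_pt (is_derive_expR_scale r^-1 s)
  (is_derive_expR_scale (- r^-1) s)) (is_derive_cst (2^-1 : R) s 1).
apply; rewrite /cosh /cst !mulNr (mulrC s); ring.
Qed.

Lemma is_derive_cosh_div (r s : R) :
  is_derive s 1 (fun t => cosh (t / r)) (r^-1 * sinh (s / r)).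
Proof.
have -> : (fun t => cosh (t / r)) =
    (fun t => (expR (r^-1 * t) + expR (- r^-1 * t)) * 2^-1).
  by apply/funext => t; rewrite /cosh mulNr (mulrC r^-1).
have /is_derive_eq := is_deriveM_pt (is_deriveD_pt (is_derive_expR_scale r^-1 s)
  (is_derive_expR_scale (- r^-1) s)) (is_derive_cst (2^-1 : R) s 1).
apply; rewrite /sinh /cst !mulNr (mulrC s); ring.
Qed.

Lemma cosh2_sub_sinh2 (x : R) : cosh x ^+ 2 - sinh x ^+ 2 = 1.
Proof.
have := expRD x (- x); rewrite subrr expR0 => /esym xx.
by rewrite -[RHS]xx /cosh /sinh; field.
Qed.

End IntervalCalculus.

(** * Curves in the Lorentz plane *)

Section Vectors.
Context {R : realType}.

Lemma mulmx_cV2E (A : 'M[R]_2) (u : 'cV[R]_2) i :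
  (A *m u) i 0 = A i 0 * u 0 0 + A i 1 * u 1 0.
Proof.
by rewrite mxE big_ord_recl big_ord1; congr (_ + A i _ * u _ _); exact/val_inj.
Qed.

Lemma cV2_eq (u v : 'cV[R]_2) : u 0 0 = v 0 0 -> u 1 0 = v 1 0 -> u = v.
Proof.
move=> uv0 uv1; apply/colP => i.
by case: i => -[|[|//]] i2; [move: uv0|move: uv1]; congr (u _ 0 = v _ 0);
  exact/val_inj.
Qed.

Lemma lorentz_orthogonal_lorentz (A : 'M[R]_2) (u v : 'cV[R]_2) :
  lorentz_orthogonal A -> lorentz (A *m u) (A *m v) = lorentz u v.
Proof.
have lorentzE x y : lorentz x y = (x^T *m lorentz_mx R *m y) 0 0.
  rewrite /lorentz !mxE big_ord_recl big_ord1 !mxE !big_ord_recl !big_ord0 !mxE /=.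
  rewrite (_ : lift ord0 ord0 = 1); last exact/val_inj.
  rewrite !mulr1n !mulr0n; ring.
by move=> Ao; rewrite !lorentzE -[in RHS]Ao trmx_mul !mulmxA.
Qed.

Lemma vec2E0 (x y : R) : vec2 x y 0 0 = x. Proof. by rewrite mxE. Qed.

Lemma vec2E1 (x y : R) : vec2 x y 1 0 = y. Proof. by rewrite mxE. Qed.

Lemma lorentz_vec2 (x y z t : R) : lorentz (vec2 x y) (vec2 z t) = x * z - y * t.
Proof. by rewrite /lorentz !vec2E0 !vec2E1. Qed.

Lemma is_derive_cV2P (f : R -> 'cV[R]_2) (s : R) (df : 'cV[R]_2) :
  is_derive s 1 f df <->
  (is_derive s 1 (fun t => f t 0 0) (df 0 0) /\
   is_derive s 1 (fun t => f t 1 0) (df 1 0)).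
Proof.
split=> [[/[dup] der /derivable_mxP derc]|[d0 d1]].
  rewrite derive_mx// => <-; rewrite !mxE.
  by split; exact/derivableP.
have der : derivable f s 1.
  apply/derivable_mxP => -[[|[|//]] i2] j; rewrite ord1.
    by rewrite (_ : Ordinal i2 = 0); [case: d0|exact/val_inj].
  by rewrite (_ : Ordinal i2 = 1); [case: d1|exact/val_inj].
split=> //; rewrite derive_mx//; apply: cV2_eq; rewrite mxE.
  by case: d0.
by case: d1.
Qed.

Lemma is_derive_vec2 (f g : R -> R) (s df dg : R) :
  is_derive s 1 f df -> is_derive s 1 g dg ->
  is_derive s 1 (fun t => vec2 (f t) (g t)) (vec2 df dg).
Proof.
move=> Hf Hg; apply/is_derive_cV2P; rewrite vec2E0 vec2E1.
under eq_fun do rewrite vec2E0.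
by under [X in _ /\ is_derive _ _ X _]eq_fun do rewrite vec2E1.
Qed.

Lemma is_derive_mulmx (A : 'M[R]_2) (f : R -> 'cV[R]_2) (s : R) (df : 'cV[R]_2) :
  is_derive s 1 f df -> is_derive s 1 (fun t => A *m f t) (A *m df).
Proof.
move=> /is_derive_cV2P[f0 f1].
have row i : is_derive s 1 (fun t => (A *m f t) i 0) ((A *m df) i 0).
  under eq_fun do rewrite mulmx_cV2E.
  have /is_derive_eq := is_deriveD_pt
    (is_deriveM_pt (is_derive_cst (A i 0) s 1) f0)
    (is_deriveM_pt (is_derive_cst (A i 1) s 1) f1).
  by apply; rewrite mulmx_cV2E !mul0r !add0r.
by apply/is_derive_cV2P; split.
Qed.

Lemma derive_eq_on_interval_cV2 (I : set R) (f g : R -> 'cV[R]_2) s df dg :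
  is_interval I -> I° !=set0 -> (forall t, I t -> f t = g t) -> I s ->
  is_derive s 1 f df -> is_derive s 1 g dg -> df = dg.
Proof.
move=> itvI I0 fg Is /is_derive_cV2P[f0 f1] /is_derive_cV2P[g0 g1].
apply: cV2_eq.
  by apply: (derive_eq_on_interval itvI I0 _ Is f0 g0) => t /fg ->.
by apply: (derive_eq_on_interval itvI I0 _ Is f1 g1) => t /fg ->.
Qed.

(** Integration of a curve on I: a primitive is unique up to translation. *)
Lemma eq_derive_on_interval_cV2 (I : set R) (f g df : R -> 'cV[R]_2) :
  is_interval I -> (forall s, I s -> is_derive s 1 f (df s)) ->
  (forall s, I s -> is_derive s 1 g (df s)) ->
  exists c, forall s, I s -> f s = g s + c.
Proof.
move=> itvI Hf Hg.
have coord i : exists c, forall s, I s -> f s i 0 - g s i 0 = c.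
  apply: cst_on_interval => // s Is.
  have /is_derive_cV2P[f0 f1] := Hf s Is; have /is_derive_cV2P[g0 g1] := Hg s Is.
  case: i => -[|[|//]] i2.
    rewrite (_ : Ordinal i2 = 0); last exact/val_inj.
    have /is_derive_eq := is_deriveB_pt f0 g0; apply; exact: subrr.
  rewrite (_ : Ordinal i2 = 1); last exact/val_inj.
  have /is_derive_eq := is_deriveB_pt f1 g1; apply; exact: subrr.
have [[c0 Hc0] [c1 Hc1]] := (coord 0, coord 1).
exists (vec2 c0 c1) => s Is; apply: cV2_eq.
  by rewrite mxE vec2E0 -(Hc0 s Is) addrC subrK.
by rewrite mxE vec2E1 -(Hc1 s Is) addrC subrK.
Qed.

Lemma is_derive_lorentz (f g : R -> 'cV[R]_2) (s : R) df dg :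
  is_derive s 1 f df -> is_derive s 1 g dg ->
  is_derive s 1 (fun t => lorentz (f t) (g t))
    (lorentz df (g s) + lorentz (f s) dg).
Proof.
move=> /is_derive_cV2P[f0 f1] /is_derive_cV2P[g0 g1].
apply: (is_derive_eq (is_deriveB_pt (is_deriveM_pt f0 g0) (is_deriveM_pt f1 g1))).
by rewrite /lorentz; ring.
Qed.

Lemma unit_field_orthogonal_derivative (I : set R) (T dT : R -> 'cV[R]_2) s :
  is_interval I -> I° !=set0 -> (forall t, I t -> lorentz (T t) (T t) = 1) ->
  I s -> is_derive s 1 T (dT s) -> lorentz (T s) (dT s) = 0.
Proof.
move=> itvI I0 T1 Is DT.
have := derive_eq_on_interval itvI I0 T1 Is (is_derive_lorentz DT DT)
  (is_derive_cst (1 : R) s 1).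
by rewrite /lorentz; lra.
Qed.

(** In the plane the orthogonal of a unit spacelike u is the line of the
    reflected vector (u_1, u_0), which is why alpha'' and beta', both orthogonal
    to the tangent, are each carried by one scalar function. *)
Lemma lorentz_normal (u v : 'cV[R]_2) :
  lorentz u u = 1 -> lorentz u v = 0 ->
  v = (u 0 0 * v 1 0 - u 1 0 * v 0 0) *: vec2 (u 1 0) (u 0 0).
Proof.
rewrite /lorentz => uu uv; apply: cV2_eq; rewrite mxE ?vec2E0 ?vec2E1.
  rewrite -[LHS]mul1r -uu; apply/eqP; rewrite -subr_eq0; apply/eqP.
  transitivity (u 0 0 * (u 0 0 * v 0 0 - u 1 0 * v 1 0)); first by ring.
  by rewrite uv mulr0.
rewrite -[LHS]mul1r -uu; apply/eqP; rewrite -subr_eq0; apply/eqP.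
transitivity (u 1 0 * (u 0 0 * v 0 0 - u 1 0 * v 1 0)); first by ring.
by rewrite uv mulr0.
Qed.

(** By [lorentz_normal], v is a multiple f of a vector of square - 1. *)
Lemma orthogonal_to_unit_timelike (u v : 'cV[R]_2) :
  lorentz u u = 1 -> lorentz u v = 0 -> v != 0 -> lorentz v v < 0.
Proof.
move=> uu uv v0; have := lorentz_normal uu uv.
move: (_ - _) => f vE; have f0 : f != 0.
  by apply: contra v0 => /eqP f0; rewrite vE f0 scale0r.
have -> : lorentz v v = - (f ^+ 2 * lorentz u u).
  by rewrite vE /lorentz !mxE /=; ring.
by rewrite uu mulr1 oppr_lt0 exprn_even_gt0.
Qed.

Lemma lorentz_dual_vec (a b : 'cV[R]_2) :
  lorentz (dual_vec a b) (dual_vec a b) = Dual (lorentz a a) (2 * lorentz a b).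
Proof.
rewrite /lorentz !mxE; congr Dual => /=; ring.
Qed.

(** * Curvature as two real equations *)

(** For negative L the absolute value flips the sign of both components; the
    dual component then carries the factor 1/|k|, which the sign of k turns
    into the factor k of the second equation. *)
Lemma dsqrt_dabs_eqP (L M k m : R) : k != 0 -> L < 0 ->
  dsqrt (dabs (Dual L (2 * M))) = dabs (Dual k m) <->
  (L = - k ^+ 2 /\ M = - (k * m)).
Proof.
move=> k0 L0; rewrite /dabs /dsqrt /= ltr0_sg// !mulN1r -normrEsg.
have a0 : `|k| != 0 by rewrite normr_eq0.
have sgk : Num.sg k * `|k| = k by rewrite -numEsg.
split=> [[HL HM]|[-> ->]].
  have LE : - L = k ^+ 2.
    by rewrite -real_normK ?num_real// -HL sqr_sqrtr// oppr_ge0 ltW.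
  split; first by rewrite -LE opprK.
  move: HM; rewrite HL => /(congr1 ( *%R^~ `|k|)) /=.
  by rewrite [RHS]mulrAC sgk => <-; field.
rewrite opprK sqrtr_sqr; congr Dual.
by rewrite -{1}sgk; field.
Qed.

Lemma curvature_eqP (alpha beta : R -> 'cV[R]_2) (s r m : R) : r != 0 ->
  lorentz (derive1n 2 alpha s) (derive1n 2 alpha s) < 0 ->
  curvature alpha beta s = dabs (Dual r^-1 m) <->
  (lorentz (derive1n 2 alpha s) (derive1n 2 alpha s) = - r^-1 ^+ 2 /\
   lorentz (derive1n 2 alpha s) (derive1n 2 beta s) = - (r^-1 * m)).
Proof.
move=> r0 L0; rewrite /curvature /dnorm lorentz_dual_vec.
by apply: dsqrt_dabs_eqP => //; rewrite invr_eq0.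
Qed.

(** Even at an endpoint of I the derivative is two-sided, because smoothness on I
    lives on an open set around it. *)
Lemma smooth_is_derive (I : set R) (f : R -> 'cV[R]_2) n s : smooth_on I f ->
  I s -> is_derive s 1 (derive1n n f) (derive1n n.+1 f s).
Proof.
by move=> [U [_ IU /(_ n)dU]] Is; rewrite derive1nS derive1E; exact/derivableP/dU/IU.
Qed.

(** * Isometries and the real part *)

(** For p^2 - q^2 = 1 and e^2 = 1 this is, up to an overall sign, the boost with
    p = cosh and q = sinh, followed by diag(1, e). *)
Definition reflected_boost (p q e : R) : 'M[R]_2 :=
  \matrix_(i, j) (if i == 0 then [:: p; q] else [:: e * q; e * p])`_j.

Lemma reflected_boost_orthogonal p q e : e ^+ 2 = 1 -> p ^+ 2 - q ^+ 2 = 1 ->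
  lorentz_orthogonal (reflected_boost p q e).
Proof.
move=> e2 pq; apply/matrixP => i j.
rewrite !mxE !big_ord_recl big_ord0 !mxE !big_ord_recl !big_ord0 !mxE /=.
rewrite !mulr1n !mulr0n.
case: i => -[|[|//]] i2; case: j => -[|[|//]] j2 /=; rewrite ?mulr1n ?mulr0n.
- transitivity (p ^+ 2 - e ^+ 2 * q ^+ 2); first ring.
  by rewrite e2 mul1r pq.
- transitivity (p * q * (1 - e ^+ 2)); first ring.
  by rewrite e2 subrr mulr0.
- transitivity (p * q * (1 - e ^+ 2)); first ring.
  by rewrite e2 subrr mulr0.
- transitivity (q ^+ 2 - e ^+ 2 * p ^+ 2); first ring.
  by rewrite e2 mul1r -pq opprB.
Qed.

Lemma reflected_boost_mulmx p q e (u : 'cV[R]_2) :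
  reflected_boost p q e *m u =
  vec2 (p * u 0 0 + q * u 1 0) (e * (q * u 0 0 + p * u 1 0)).
Proof.
apply: cV2_eq; rewrite mulmx_cV2E ?vec2E0 ?vec2E1 !mxE /=; ring.
Qed.

Lemma cosh_sign e (x : R) : e ^+ 2 = 1 -> cosh (e * x) = cosh x.
Proof.
move=> /eqP; rewrite sqrf_eq1 => /orP[] /eqP ->; first by rewrite mul1r.
by rewrite mulN1r /cosh opprK addrC.
Qed.

Lemma sinh_sign e (x : R) : e ^+ 2 = 1 -> e * sinh (e * x) = sinh x.
Proof.
move=> /eqP; rewrite sqrf_eq1 => /orP[] /eqP ->; first by rewrite !mul1r.
by rewrite !mulN1r /sinh opprK; ring.
Qed.

End Vectors.

Section UnitTangent.
Context {R : realType}.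
Variable I : set R.
Hypotheses (itvI : is_interval I) (I0 : I° !=set0).

(** The function [w = x * dy - y * dx] satisfies [w ^+ 2 = k ^+ 2], so that
    [2 * w * w' = 0] with [w] nowhere zero: it is constant. Using its derivative
    avoids a connectedness argument for the sign of [w], at the price of one more
    derivative of [x] and [y]. *)
Lemma unit_hyperbola_constant_speed (x y dx dy d2x d2y : R -> R) (k : R) : k != 0 ->
  (forall s, I s -> [/\ is_derive s 1 x (dx s), is_derive s 1 y (dy s),
    is_derive s 1 dx (d2x s) & is_derive s 1 dy (d2y s)]) ->
  (forall s, I s -> x s ^+ 2 - y s ^+ 2 = 1) ->
  (forall s, I s -> dx s ^+ 2 - dy s ^+ 2 = - k ^+ 2) ->
  exists w, w ^+ 2 = k ^+ 2 /\
    forall s, I s -> dx s = w * y s /\ dy s = w * x s.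
Proof.
move=> k0 der xy1 dxyk.
have xdx s : I s -> x s * dx s = y s * dy s.
  move=> Is; have [Dx Dy _ _] := der s Is.
  have := derive_eq_on_interval itvI I0 xy1 Is
    (is_deriveB_pt (is_deriveM_pt Dx Dx) (is_deriveM_pt Dy Dy))
    (is_derive_cst (1 : R) s 1).
  lra.
pose w s := x s * dy s - y s * dx s.
have wE s : I s -> dx s = w s * y s /\ dy s = w s * x s.
  move=> Is; have := xdx s Is; have := xy1 s Is; rewrite /w => e1 e2; split.
    rewrite -[LHS]mul1r -e1 mulrBl; apply/eqP; rewrite -subr_eq0; apply/eqP.
    transitivity (x s * (x s * dx s - y s * dy s)); first by ring.
    by rewrite e2 subrr mulr0.
  rewrite -[LHS]mul1r -e1 mulrBl; apply/eqP; rewrite -subr_eq0; apply/eqP.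
  transitivity (y s * (x s * dx s - y s * dy s)); first by ring.
  by rewrite e2 subrr mulr0.
have w2 s : I s -> w s ^+ 2 = k ^+ 2.
  move=> Is; have [ex ey] := wE s Is.
  apply: oppr_inj; rewrite -(dxyk s)// ex ey.
  transitivity (- w s ^+ 2 * (x s ^+ 2 - y s ^+ 2)); last by ring.
  by rewrite xy1// mulr1.
have w_cst : exists c, forall s, I s -> w s = c.
  apply: cst_on_interval => // s Is.
  have [Dx Dy D2x D2y] := der s Is.
  have Dw := is_deriveB_pt (is_deriveM_pt Dx D2y) (is_deriveM_pt Dy D2x).
  apply: (is_derive_eq Dw).
  have := derive_eq_on_interval itvI I0 w2 Is (is_deriveM_pt Dw Dw)
    (is_derive_cst (k ^+ 2) s 1).
  rewrite -/(w s) mulrC -mulr2n => /eqP; rewrite mulrn_eq0 /= mulf_eq0.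
  by rewrite -sqrf_eq0 w2// sqrf_eq0 (negbTE k0) => /eqP.
have [c wc] := w_cst.
have [s0 /interior_subset Is0] := I0.
exists c; split; first by rewrite -(wc s0)// w2.
by move=> s Is; rewrite -(wc s)//; exact: wE.
Qed.

(** In light-cone coordinates the system is [(x + y)' = w * (x + y)] and
    [(x - y)' = - w * (x - y)], with solutions c exp (ws) and d exp (- ws);
    the constraint x^2 - y^2 = 1 says that c d = 1, and the boost divides the
    first coordinate by c and the second one by d. *)
Lemma boost_to_hyperbola (x y : R -> R) (w : R) :
  (forall s, I s -> is_derive s 1 x (w * y s)) ->
  (forall s, I s -> is_derive s 1 y (w * x s)) ->
  (forall s, I s -> x s ^+ 2 - y s ^+ 2 = 1) ->
  exists p q, p ^+ 2 - q ^+ 2 = 1 /\ forall s, I s ->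
    p * x s + q * y s = cosh (w * s) /\ q * x s + p * y s = sinh (w * s).
Proof.
move=> Dx Dy xy1.
have [c Hc] : exists c, forall s, I s -> (x s + y s) * expR (- w * s) = c.
  apply: cst_on_interval => // s Is.
  have /is_derive_eq := is_deriveM_pt (is_deriveD_pt (Dx s Is) (Dy s Is))
    (is_derive_expR_scale (- w) s).
  by apply; ring.
have [d Hd] : exists d, forall s, I s -> (x s - y s) * expR (w * s) = d.
  apply: cst_on_interval => // s Is.
  have /is_derive_eq := is_deriveM_pt (is_deriveB_pt (Dx s Is) (Dy s Is))
    (is_derive_expR_scale w s).
  by apply; ring.
have EE s : expR (w * s) * expR (- w * s) = 1.
  by rewrite -expRD mulNr subrr expR0.
have [s0 /interior_subset Is0] := I0.
have cd : c * d = 1.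
  rewrite -(Hc s0)// -(Hd s0)//.
  transitivity ((x s0 ^+ 2 - y s0 ^+ 2) * (expR (w * s0) * expR (- w * s0))).
    by ring.
  by rewrite EE mulr1 xy1.
(* The map multiplying x + y by d = 1/c and x - y by c. *)
exists ((d + c) / 2), ((d - c) / 2); split.
  by rewrite -[RHS]cd; field.
move=> s Is.
have u : x s + y s = c * expR (w * s).
  by rewrite -(Hc s Is) -mulrA [_ * expR (w * s)]mulrC EE mulr1.
have v : x s - y s = d * expR (- w * s).
  by rewrite -(Hd s Is) -mulrA EE mulr1.
rewrite /cosh /sinh -mulNr; split.
  transitivity ((d * (x s + y s) + c * (x s - y s)) / 2); first by field.
  by rewrite u v !mulrA [d * c]mulrC cd !mul1r.
transitivity ((d * (x s + y s) - c * (x s - y s)) / 2); first by field.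
by rewrite u v !mulrA [d * c]mulrC cd !mul1r.
Qed.

(** A boost brings T to (cosh ws, sinh ws) with w = 1/r or - 1/r; the sign
    [e = w * r] is removed by diag(1, e), as cosh is even and sinh odd. *)
Lemma unit_tangent_normal_form (T dT d2T : R -> 'cV[R]_2) (r : R) : r != 0 ->
  (forall s, I s -> is_derive s 1 T (dT s)) ->
  (forall s, I s -> is_derive s 1 dT (d2T s)) ->
  (forall s, I s -> lorentz (T s) (T s) = 1) ->
  (forall s, I s -> lorentz (dT s) (dT s) = - r^-1 ^+ 2) ->
  exists A, lorentz_orthogonal A /\
    forall s, I s -> A *m T s = vec2 (cosh (s / r)) (sinh (s / r)).
Proof.
move=> r0 DT D2T T1 dTr.
have [||s Is|s Is|w [w2 HT]] := @unit_hyperbola_constant_speed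
  (fun s => T s 0 0) (fun s => T s 1 0) (fun s => dT s 0 0) (fun s => dT s 1 0)
  (fun s => d2T s 0 0) (fun s => d2T s 1 0) r^-1.
- by rewrite invr_eq0.
- move=> s Is; have /is_derive_cV2P[] := DT s Is.
  by have /is_derive_cV2P[] := D2T s Is.
- by rewrite -(T1 s Is).
- by rewrite -(dTr s Is).
have [s Is|s Is|s Is|p [q [pq Hpq]]] :=
    @boost_to_hyperbola (fun s => T s 0 0) (fun s => T s 1 0) w.
- have [<- _] := HT s Is; by have /is_derive_cV2P[] := DT s Is.
- have [_ <-] := HT s Is; by have /is_derive_cV2P[] := DT s Is.
- by rewrite -(T1 s Is).
have e2 : (w * r) ^+ 2 = 1 by rewrite exprMn w2 -exprMn mulVf// expr1n.
exists (reflected_boost p q (w * r)); split.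
  exact: reflected_boost_orthogonal.
move=> s Is; have [ch sh] := Hpq s Is; rewrite reflected_boost_mulmx ch sh.
have -> : w * s = w * r * (s / r) by field.
by rewrite cosh_sign// sinh_sign.
Qed.

End UnitTangent.

(** * The model curves *)

Section Model.
Context {R : realType}.
Variables (r m n s : R).
Hypothesis r0 : r != 0.

Lemma is_derive_unit_tangent : is_derive s 1
  (fun t => vec2 (cosh (t / r)) (sinh (t / r)))
  (r^-1 *: vec2 (sinh (s / r)) (cosh (s / r))).
Proof.
have /is_derive_eq := is_derive_vec2 (is_derive_cosh_div r s) (is_derive_sinh_div r s).
by apply; apply: cV2_eq; rewrite !mxE.
Qed.

Lemma is_derive_hyperbola : is_derive s 1
  (fun t => r *: vec2 (sinh (t / r)) (cosh (t / r)))
  (vec2 (cosh (s / r)) (sinh (s / r))).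
Proof.
apply/is_derive_cV2P; split.
  under eq_fun do rewrite mxE vec2E0.
  have /is_derive_eq := is_deriveM_pt (is_derive_cst r s 1) (is_derive_sinh_div r s).
  by apply; rewrite vec2E0 mul0r add0r mulrA divff// mul1r.
under eq_fun do rewrite mxE vec2E1.
have /is_derive_eq := is_deriveM_pt (is_derive_cst r s 1) (is_derive_cosh_div r s).
by apply; rewrite vec2E1 mul0r add0r mulrA divff// mul1r.
Qed.

Lemma is_derive_affine : is_derive s 1 (fun t => m * t + n) m.
Proof.
have /is_derive_eq := is_deriveD_pt (is_deriveM_pt (is_derive_cst m s 1)
  (is_derive_id s 1)) (is_derive_cst n s 1).
by apply; rewrite mul0r add0r mulr1 addr0.
Qed.

Lemma is_derive_dual_tangent : is_derive s 1
  (fun t => (m * t + n) *: vec2 (sinh (t / r)) (cosh (t / r)))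
  (m *: vec2 (sinh (s / r)) (cosh (s / r)) +
   ((m * s + n) / r) *: vec2 (cosh (s / r)) (sinh (s / r))).
Proof.
apply/is_derive_cV2P; split.
  under eq_fun do rewrite mxE vec2E0.
  have /is_derive_eq := is_deriveM_pt is_derive_affine (is_derive_sinh_div r s).
  by apply; rewrite !mxE /=; ring.
under eq_fun do rewrite mxE vec2E1.
have /is_derive_eq := is_deriveM_pt is_derive_affine (is_derive_cosh_div r s).
by apply; rewrite !mxE /=; ring.
Qed.

(** The terms in m r (cosh, sinh) coming from the two summands cancel, so the
    derivative stays orthogonal to the tangent (cosh (s/r), sinh (s/r)). *)
Lemma is_derive_dual_hyperbola : is_derive s 1
  (fun t =>
    vec2 (- m * r ^+ 2 * sinh (t / r) + (m * t + n) * r * cosh (t / r))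
         (- m * r ^+ 2 * cosh (t / r) + (m * t + n) * r * sinh (t / r)))
  ((m * s + n) *: vec2 (sinh (s / r)) (cosh (s / r))).
Proof.
have Dc := is_derive_cosh_div r s; have Ds := is_derive_sinh_div r s.
have Da := is_deriveM_pt is_derive_affine (is_derive_cst r s 1).
have Dk := is_derive_cst (- m * r ^+ 2) s 1.
have /is_derive_eq := is_derive_vec2
  (is_deriveD_pt (is_deriveM_pt Dk Ds) (is_deriveM_pt Da Dc))
  (is_deriveD_pt (is_deriveM_pt Dk Dc) (is_deriveM_pt Da Ds)).
by apply; apply: cV2_eq; rewrite !mxE /= /cst; field.
Qed.

Lemma model_curvature_products (A : 'M[R]_2) (u v : 'cV[R]_2) :
  lorentz_orthogonal A ->
  A *m u = r^-1 *: vec2 (sinh (s / r)) (cosh (s / r)) ->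
  A *m v = m *: vec2 (sinh (s / r)) (cosh (s / r)) +
    ((m * s + n) / r) *: vec2 (cosh (s / r)) (sinh (s / r)) ->
  lorentz u u = - r^-1 ^+ 2 /\ lorentz u v = - (r^-1 * m).
Proof.
move=> Ao Au Av.
have chsh : sinh (s / r) ^+ 2 - cosh (s / r) ^+ 2 = -1.
  by rewrite -opprB cosh2_sub_sinh2.
split; rewrite -[LHS](lorentz_orthogonal_lorentz _ _ Ao) Au ?Av /lorentz !mxE /=.
  transitivity (r^-1 ^+ 2 * (sinh (s / r) ^+ 2 - cosh (s / r) ^+ 2)).
    by ring.
  by rewrite chsh mulrN1.
transitivity (r^-1 * m * (sinh (s / r) ^+ 2 - cosh (s / r) ^+ 2)).
  by ring.
by rewrite chsh mulrN1.
Qed.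

End Model.

(** * The dual part *)

Section DualPart.
Context {R : realType}.
Variable I : set R.
Hypothesis itvI : is_interval I.

(** Orthogonality gives [B = f *: vec2 sinh cosh]. Writing
    [f = cosh * B1 - sinh * B0], the derivatives of cosh and sinh contribute a
    multiple of <(cosh, sinh), B> = 0, and what remains of f' is - r times the
    product prescribed in the last hypothesis, namely m. *)
Lemma dual_tangent_normal_form (B dB : R -> 'cV[R]_2) (r m : R) : r != 0 ->
  (forall s, I s -> is_derive s 1 B (dB s)) ->
  (forall s, I s -> lorentz (vec2 (cosh (s / r)) (sinh (s / r))) (B s) = 0) ->
  (forall s, I s ->
     lorentz (r^-1 *: vec2 (sinh (s / r)) (cosh (s / r))) (dB s) = - (r^-1 * m)) ->
  exists n, forall s, I s ->
    B s = (m * s + n) *: vec2 (sinh (s / r)) (cosh (s / r)).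
Proof.
move=> r0 DB TB NdB.
pose f t := cosh (t / r) * B t 1 0 - sinh (t / r) * B t 0 0.
have BE s : I s -> B s = f s *: vec2 (sinh (s / r)) (cosh (s / r)).
  move=> Is; have := lorentz_normal _ (TB s Is); rewrite !vec2E0 !vec2E1; apply.
  by rewrite lorentz_vec2 -!expr2 cosh2_sub_sinh2.
have [n Hn] : exists n, forall s, I s -> f s - m * s = n.
  apply: (cst_on_interval (f := fun s => f s - m * s) itvI) => s Is.
  have /is_derive_cV2P[DB0 DB1] := DB s Is.
  have Dc := is_derive_cosh_div r s; have Ds := is_derive_sinh_div r s.
  have Dm := is_deriveM_pt (is_derive_cst m s 1) (is_derive_id s 1).
  apply: (is_derive_eq (is_deriveB_pt
    (is_deriveB_pt (is_deriveM_pt Dc DB1) (is_deriveM_pt Ds DB0)) Dm)).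
  have := NdB s Is; have := TB s Is.
  rewrite /lorentz !mxE /= => e1 e2.
  rewrite mul0r add0r mulr1.
  transitivity (- r^-1 * (cosh (s / r) * B s 0 0 - sinh (s / r) * B s 1 0)
    - r * (r^-1 * sinh (s / r) * dB s 0 0 - r^-1 * cosh (s / r) * dB s 1 0) - m).
    by field.
  by rewrite e1 e2; field.
exists n => s Is; rewrite (BE s Is); congr (_ *: _).
by rewrite -(Hn s Is) addrC subrK.
Qed.

End DualPart.

(** * The classification theorem *)

Unset Implicit Arguments.
Set Strict Implicit.

Theorem theorem4p8 (R : realType) (I : set R) (alpha beta : R -> 'cV[R]_2)
  (I_interval : is_interval I) (I_nondegenerate : I° !=set0)
  (alpha_smooth : smooth_on I alpha) (beta_smooth : smooth_on I beta)
  (gamma_spacelike : spacelike_on I alpha)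
  (gamma_arclength : arclength_on I alpha beta)
  (alpha''_neq0 : forall s, I s -> derive1n 2 alpha s != 0)
  (r m : R) (r_neq0 : r != 0) :
  (forall s, I s -> curvature alpha beta s = dabs (Dual r^-1 m))
  <->
  (exists (A : 'M[R]_2) (b : 'cV[R]_2), lorentz_orthogonal A /\
    (forall s, I s ->
      A *m alpha s + b = r *: vec2 (sinh (s / r)) (cosh (s / r))) /\
    exists (n : R) (beta0 : 'cV[R]_2), forall s, I s ->
      A *m beta s =
        vec2 (- m * r ^+ 2 * sinh (s / r) + (m * s + n) * r * cosh (s / r))
             (- m * r ^+ 2 * cosh (s / r) + (m * s + n) * r * sinh (s / r))
        + beta0).
Proof.
have Da k s : I s -> is_derive s 1 (derive1n k alpha) (derive1n k.+1 alpha s).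
  exact: smooth_is_derive.
have Db k s : I s -> is_derive s 1 (derive1n k beta) (derive1n k.+1 beta s).
  exact: smooth_is_derive.
have curvP s : I s -> curvature alpha beta s = dabs (Dual r^-1 m) <->
    (lorentz (derive1n 2 alpha s) (derive1n 2 alpha s) = - r^-1 ^+ 2 /\
     lorentz (derive1n 2 alpha s) (derive1n 2 beta s) = - (r^-1 * m)).
  move=> Is; apply: curvature_eqP => //.
  have [a1 _] := gamma_arclength s Is.
  apply: (orthogonal_to_unit_timelike a1); last exact: alpha''_neq0.
  apply: (unit_field_orthogonal_derivative (dT := derive1n 2 alpha)
    I_interval I_nondegenerate _ Is (Da 1%N s Is)) => t It.
  by have [] := gamma_arclength t It.
split=> [curv|[A [b [Ao [HA [n [b0 HB]]]]]] s Is].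
  have [A [Ao HT]] : exists A, lorentz_orthogonal A /\ forall s, I s ->
      A *m derive1n 1 alpha s = vec2 (cosh (s / r)) (sinh (s / r)).
    apply: (unit_tangent_normal_form I_interval I_nondegenerate r_neq0
      (Da 1%N) (Da 2%N)) => s Is.
      by have [] := gamma_arclength s Is.
    by have [] := (curvP s Is).1 (curv s Is).
  have HN s : I s ->
      A *m derive1n 2 alpha s = r^-1 *: vec2 (sinh (s / r)) (cosh (s / r)).
    move=> Is; apply: (derive_eq_on_interval_cV2 I_interval I_nondegenerate HT Is).
      exact/is_derive_mulmx/Da.
    exact: is_derive_unit_tangent.
  have [n HB] : exists n, forall s, I s -> A *m derive1n 1 beta s =
      (m * s + n) *: vec2 (sinh (s / r)) (cosh (s / r)).
    apply: (dual_tangent_normal_form I_interval r_neq0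
      (dB := fun s => A *m derive1n 2 beta s)) => s Is.
    - exact/is_derive_mulmx/Db.
    - rewrite -HT// lorentz_orthogonal_lorentz//.
      by have [] := gamma_arclength s Is.
    - rewrite -HN// lorentz_orthogonal_lorentz//.
      by have [] := (curvP s Is).1 (curv s Is).
  have [c Hc] : exists c, forall s, I s ->
      A *m alpha s = r *: vec2 (sinh (s / r)) (cosh (s / r)) + c.
    apply: (eq_derive_on_interval_cV2
      (df := fun s => A *m derive1n 1 alpha s)) => // s Is.
      exact: is_derive_mulmx (Da 0%N s Is).
    by rewrite HT//; exact: is_derive_hyperbola.
  exists A, (- c); split=> //; split=> [s Is|]; first by rewrite Hc// addrK.
  exists n; apply: (eq_derive_on_interval_cV2
    (df := fun s => A *m derive1n 1 beta s)) => // s Is.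
    exact: is_derive_mulmx (Db 0%N s Is).
  by rewrite HB//; exact: is_derive_dual_hyperbola.
have HT t : I t -> A *m derive1n 1 alpha t = vec2 (cosh (t / r)) (sinh (t / r)).
  move=> It; apply: (derive_eq_on_interval_cV2 (f := fun u => A *m alpha u)
    (g := fun u => r *: vec2 (sinh (u / r)) (cosh (u / r)) - b)
    I_interval I_nondegenerate _ It).
  - by move=> u Iu; rewrite -HA// addrK.
  - exact: is_derive_mulmx (Da 0%N t It).
  - have /is_derive_eq := is_deriveB (is_derive_hyperbola t r_neq0)
      (is_derive_cst b t 1).
    by apply; rewrite subr0.
have HN : A *m derive1n 2 alpha s = r^-1 *: vec2 (sinh (s / r)) (cosh (s / r)).
  apply: (derive_eq_on_interval_cV2 I_interval I_nondegenerate HT Is).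
    exact/is_derive_mulmx/Da.
  exact: is_derive_unit_tangent.
have HB1 t : I t ->
    A *m derive1n 1 beta t = (m * t + n) *: vec2 (sinh (t / r)) (cosh (t / r)).
  move=> It; apply: (derive_eq_on_interval_cV2 I_interval I_nondegenerate HB It).
    exact: is_derive_mulmx (Db 0%N t It).
  have /is_derive_eq := is_deriveD (is_derive_dual_hyperbola m n t r_neq0)
    (is_derive_cst b0 t 1).
  by apply; rewrite addr0.
have HB2 : A *m derive1n 2 beta s = m *: vec2 (sinh (s / r)) (cosh (s / r)) +
    ((m * s + n) / r) *: vec2 (cosh (s / r)) (sinh (s / r)).
  apply: (derive_eq_on_interval_cV2 I_interval I_nondegenerate HB1 Is).
    exact/is_derive_mulmx/Db.
  exact: is_derive_dual_tangent.
by apply/(curvP s Is)/(model_curvature_products Ao HN HB2).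
Qed.
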